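(* Let $X$ be a finite simple cycle set. Then the following statements are equivalent: (1) $\mathrm{Dis}(X)$ is cyclic; (2) $|\mathrm{Dis}(X)|=1$; (3) $|X|=2$ or $X$ is an indecomposable cycle set of prime size.
   Context: A left quasigroup $(X,\cdot)$ is a non-empty set with a binary operation such that $\sigma_x:y\mapsto x\cdot y$ is bijective for every $x\in X$. A cycle set is a left quasigroup with $(x\cdot y)\cdot(x\cdot z)=(y\cdot x)\cdot(y\cdot z)$ for all $x,y,z\in X$; all cycle sets are assumed non-degenerate, i.e. $x\mapsto x\cdot x$ is bijective. $\mathcal{G}(X)=\langle\sigma_x\mid x\in X\rangle\le \mathrm{Sym}(X)$; $X$ is indecomposable if $\mathcal{G}(X)$ is transitive on $X$, and decomposable otherwise. The displacement group $\mathrm{Dis}(X)$ is the normal closure of $\{\sigma_x\sigma_y^{-1}\mid x,y\in X\}$ in $\mathcal{G}(X)$. A congruence is an equivalence relation $\sim$ on $X$ such that $x\sim x'$ and $y\sim y'$ imply $x\cdot y\sim x'\cdot y'$ and $\sigma_x^{-1}(y)\sim\sigma_{x'}^{-1}(y')$. Here $X$ is simple if its only congruences are the equality relation and the relation in which all elements are equivalent.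
   Formalization: The formal theorem assumes that X has more than one element; under the stated definition the one-element cycle set is simple and satisfies (1) and (2) but not (3), so the claim fails for it. *)

(* Defs.v *)
From mathcomp Require Import all_boot all_fingroup all_solvable.

Set Implicit Arguments.
Unset Strict Implicit.
Unset Printing Implicit Defensive.

Import GroupScope.

Record finLeftQuasigroup := FinLeftQuasigroup {
  lq_sort :> finType;
  lq_op : lq_sort -> lq_sort -> lq_sort;
  lq_nonempty : inhabited lq_sort;
  lq_bij : forall x, bijective (lq_op x)
}.

Declare Scope lq_scope.
Delimit Scope lq_scope with LQ.
Notation "x ⋅ y" := (lq_op x y) (at level 40, left associativity) : lq_scope.

Section LeftQuasigroup.

Variable X : finLeftQuasigroup.
Implicit Types (x y z : X) (r : rel X).

Definition sigma x : {perm X} := perm (bij_inj (lq_bij x)).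

Definition cycle_set : Prop :=
  forall x y z, ((x ⋅ y) ⋅ (x ⋅ z) = (y ⋅ x) ⋅ (y ⋅ z))%LQ.

Definition nondegenerate : Prop := bijective (fun x => (x ⋅ x)%LQ).

Definition lq_group : {group {perm X}} := <<[set sigma x | x : X]>>%G.

Definition indecomposable : bool := [transitive lq_group, on [set: X] | 'P].

(* The product of {perm X} applies its left factor first, so the composite
   map sigma_x o sigma_y^-1 is written (sigma y)^-1 * sigma x. *)
Definition dis_gens : {set {perm X}} :=
  [set (sigma y)^-1 * sigma x | x : X, y : X].

(* The normal closure in lq_group, generated by all lq_group-conjugates. *)
Definition Dis : {group {perm X}} := <<class_support dis_gens lq_group>>%G.

Definition congruence r : Prop :=
  [/\ equivalence_rel r,
      forall x x' y y', r x x' -> r y y' -> r (x ⋅ y)%LQ (x' ⋅ y')%LQ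
    & forall x x' y y', r x x' -> r y y' ->
        r ((sigma x)^-1 y) ((sigma x')^-1 y')].

(* A one-element X satisfies this predicate; it has to be excluded separately
   where, as for simple groups, the trivial structure does not count as simple. *)
Definition simple_lq : Prop :=
  forall r, congruence r -> r =2 eq_op \/ (forall x y, r x y).

End LeftQuasigroup.

(* Main.v *)
(* The permutation group G of X carries a second, commutative group law, with
   neutral element 1 and with sigma x + sigma y given by both sides of
   [sigmaM]; it is realised here by the abelian group A of the translations
   g |-> g + sigma x, which is regular on G and on which G acts by
   automorphisms, g sending the translation by sigma x to that by sigma (g x).
   A G-stable subgroup N of A thus yields a subgroup [lideal] of G of the same
   order.  If N contains all differences of translations, then this subgroup
   contains Dis.

   For X indecomposable of prime size p, the p-part of A has order p, so it is
   centralised by an element of order p of G; as the latter is transitive on X,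
   all translations agree modulo the p'-part N of A.  Hence Dis is a p'-group
   and cannot be transitive; by simplicity it is trivial.

   Assume now that Dis is cyclic and nontrivial.  By simplicity sigma is
   injective and Dis is transitive, hence regular, so the translations by the
   sigma x fill a whole coset of the group B of their differences.  Every
   subgroup of Dis is normal in G, so every G-stable subgroup of B induces a
   congruence of X.  Simplicity makes B irreducible under G, hence elementary
   abelian for some p and centralised by the p-group Dis.  Then Dis has exponent
   p, so |X| = |Dis| = p and the previous case applies. *)
Require Import Defs.
From mathcomp Require Import all_boot all_fingroup all_solvable.

Set Implicit Arguments.
Unset Strict Implicit.
Unset Printing Implicit Defensive.

Import GroupScope.

(** * Fixed points of p-groups and orders of permutation groups *)

Lemma pgroup_cent_nontrivial (gT : finGroupType) (p : nat) (P Q : {group gT}) :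
  p.-group P -> p.-group Q -> Q \subset 'N(P) -> P :!=: 1 -> 'C_P(Q) != 1.
Proof.
move=> pP pQ nPQ P_n1.
have pPQ : p.-group (P <*> Q) by rewrite norm_joinEr // pgroupM pP.
have nsP : P <| P <*> Q by rewrite /normal joing_subl join_subG normG.
(* [P] is normal in the p-group [P <*> Q], so it meets the centre of that group nontrivially. *)
apply: contraNneq (meet_center_nil (pgroup_nil pPQ) nsP P_n1) => CP1.
rewrite -subG1 -CP1 setIS // subIset // orbC.
by rewrite (subset_trans (centS (joing_subr P Q))).
Qed.

Lemma logn_fact_prime p : prime p -> logn p p`! = 1%N.
Proof.
move=> p_pr; have := prime_gt1 p_pr; case: p p_pr => // p p_pr p_gt1.
rewrite factS lognM ?fact_gt0 // logn_prime // eqxx /= logn_coprime //.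
(* By Wilson's theorem the prime [p.+1] divides p! + 1, so it cannot also divide p!. *)
rewrite prime_coprime //; apply/negP=> dv; have := p_pr; rewrite Wilson //=.
by rewrite -[p`!.+1]addn1 dvdn_addr // dvdn1 => /eqP E; rewrite E in p_gt1.
Qed.

Lemma dvdn_card_perm (T : finType) (H : {group {perm T}}) : #|H| %| #|T|`!.
Proof.
have <- : #|[set: {perm T}]| = #|T|`!.
  rewrite -cardsT -card_perm; apply: eq_card => s; rewrite !inE.
  by apply/esym/subsetP=> x; rewrite !inE.
exact/cardSg/subsetT.
Qed.

(** * The displacement group and orbit congruences *)

Section Displacement.

Variable X : finLeftQuasigroup.
Implicit Types (x y z : X) (r : rel X) (g h k : {perm X}).

Local Notation G := (lq_group X).
Local Notation D := (Dis X).

Lemma sigmaE x y : sigma x y = (x ⋅ y)%LQ.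
Proof. by rewrite permE. Qed.

Lemma mem_sigma x : sigma x \in G.
Proof. by rewrite mem_gen // imset_f. Qed.

Lemma Dis_normal : D <| G.
Proof.
rewrite /normal gen_subG; apply/andP; split.
  apply/subsetP=> _ /imset2P[_ k /imset2P[x y _ _ ->] Gk ->].
  by rewrite groupJ // groupM ?groupV ?mem_sigma.
exact: subset_trans (class_support_norm _ _) (norm_gen _).
Qed.

Lemma mem_Dis x y : (sigma y)^-1 * sigma x \in D.
Proof.
rewrite mem_gen //; apply/imset2P.
exists ((sigma y)^-1 * sigma x) 1; rewrite ?group1 ?conjg1 //.
by apply/imset2P; exists x y.
Qed.

Lemma Dis_subset (H : {group {perm X}}) :
  H <| G -> (forall x y, (sigma y)^-1 * sigma x \in H) -> D \subset H.
Proof.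
case/andP=> _ nHG dH; rewrite gen_subG.
apply/subsetP=> _ /imset2P[_ k /imset2P[x y _ _ ->] Gk ->].
by rewrite memJ_norm ?(subsetP nHG).
Qed.

(** [G] permutes the orbits of [H], and all [sigma x] act alike on these orbits because their
    quotients lie in [D]. *)
Lemma orbit_congruence (H : {group {perm X}}) :
  G \subset 'N(H) -> D \subset H -> congruence (fun x y => y \in orbit 'P H x).
Proof.
move=> nHG sDH.
have stab k x y : k \in G -> y \in orbit 'P H x -> k y \in orbit 'P H (k x).
  move=> Gk /orbitP[h Hh <-]; apply/orbitP; exists (h ^ k).
    by rewrite memJ_norm ?(subsetP nHG).
  by rewrite /= /aperm -!permM /conjg !mulgA mulgV mul1g.
split=> [x y z|x x' y y' _ ryy'|x x' y y' _ ryy'].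
- split=> [|rxy]; first exact: orbit_refl.
  by rewrite (orbit_eqP rxy).
- rewrite -!sigmaE; apply: (orbit_trans (y := sigma x y')); last first.
    exact: stab (mem_sigma x) ryy'.
  apply/orbitP; exists ((sigma x)^-1 * sigma x').
    exact/(subsetP sDH)/mem_Dis.
  by rewrite /= /aperm permM permK.
- apply: (orbit_trans (y := (sigma x)^-1 y')); last first.
    by apply: stab ryy'; rewrite groupV mem_sigma.
  apply/orbitP; exists (sigma x * (sigma x')^-1).
    have: ((sigma x')^-1 * sigma x) ^ (sigma x')^-1 \in H.
      by rewrite memJ_norm ?(subsetP nHG) ?groupV ?mem_sigma ?(subsetP sDH) ?mem_Dis.
    by rewrite /conjg invgK !mulgA mulgV mul1g.
  by rewrite /= /aperm permM permKV.
Qed.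

Hypothesis X_simple : simple_lq X.

Lemma simple_orbits (H : {group {perm X}}) :
  G \subset 'N(H) -> D \subset H ->
  H :=: 1 \/ [transitive H, on [set: X] | 'P].
Proof.
move=> nHG sDH; case: (X_simple (orbit_congruence nHG sDH)) => [eqH|totH].
  left; apply/trivgP/subsetP=> h Hh; apply/set1P/permP=> x.
  have := eqH x (h x); rewrite perm1 => E; apply/eqP.
  by rewrite eq_sym -E; apply/orbitP; exists h.
right; case: (lq_nonempty X) => x0; apply/imsetP; exists x0 => //.
by apply/setP=> y; rewrite inE totH.
Qed.

(** All [sigma x] coincide, so [G] is abelian and each of its subgroups is trivial or transitive.
    This is applied to [G] and to a subgroup of prime order. *)
Lemma trivial_Dis_simple : 1 < #|X| -> #|D| = 1%N ->
  #|X| = 2 \/ indecomposable X /\ prime #|X|.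
Proof.
move=> X_gt1 /card1_trivg D1.
have sigma_const x y : sigma x = sigma y.
  have := mem_Dis x y; rewrite D1 => /set1P E.
  by rewrite -[sigma x](mulKVg (sigma y)) E mulg1.
have cGG : abelian G.
  rewrite abelian_gen; apply/centsP=> _ /imsetP[x _ ->] _ /imsetP[y _ ->].
  by rewrite (sigma_const x y).
have orbs (H : {group {perm X}}) : H \subset G ->
    H :=: 1 \/ [transitive H, on [set: X] | 'P].
  move=> sHG; apply: simple_orbits; last by rewrite D1 sub1G.
  exact: sub_abelian_norm.
case: (orbs G (subxx _)) => [G1|trG].
  left; have sigma1 x y : (x ⋅ y)%LQ = y.
    have := mem_sigma x; rewrite -sigmaE -[gval _]/(G : {set _}) G1.
    by move/set1P->; rewrite perm1.
  have [x [y /= [_ _ nxy]]] : exists x y, [/\ x \in X, y \in X & x != y].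
    by apply/card_gt1P.
  (* As [G] is trivial, every equivalence relation is a congruence; the one gluing only [x] and [y]
     must be total. *)
  pose r : rel X := fun a b => (a == b) || (a \in [set x; y]) && (b \in [set x; y]).
  have rcong : congruence r.
    split=> [a b c|a a' b b' _|a a' b b' _].
    - rewrite /r eqxx; split=> // /orP[/eqP->//|/andP[ha hb]].
      rewrite ha hb /=; have [hc|hc] := boolP (c \in _); first by rewrite !orbT.
      by rewrite !orbF; apply/eqP/eqP => E; move: hc; rewrite -E ?ha ?hb.
    - by rewrite !sigma1.
    - have s1 z : sigma z = 1 by apply/permP=> t; rewrite sigmaE sigma1 perm1.
      by rewrite !s1 invg1 !perm1.
  have [E|tot] := X_simple rcong.
    by have := E x y; rewrite /r !inE !eqxx orbT (negbTE nxy).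
  have -> : #|X| = #|[set x; y]|; last by rewrite cards2 nxy.
  rewrite -cardsT; congr #|pred_of_set _|; apply/setP=> z.
  rewrite in_setT; apply/esym; have := tot x z; rewrite /r.
  by case/orP=> [/eqP<-|/andP[_ ->//]]; rewrite set21.
right; split=> //.
have G_n1 : #|G| != 1%N.
  apply: contraTneq X_gt1 => G1; rewrite -leqNgt -cardsT -[leqRHS]G1.
  exact/dvdn_leq/(atrans_dvd trG)/cardG_gt0.
have [p p_pr p_dv] : exists2 p, prime p & p %| #|G|.
  by exists (pdiv #|G|); rewrite ?pdiv_dvd // pdiv_prime // ltn_neqAle eq_sym G_n1 cardG_gt0.
have [s Gs os] := Cauchy p_pr p_dv.
have [S1|trS] := orbs <[s]>%G (etrans (cycle_subG _ _) Gs).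
  by move: os p_pr; rewrite /order S1 cards1 => <-.
have := atrans_dvd trS; rewrite -[#|<[s]>|]/#[s] os cardsT => n_dv.
by rewrite (prime_nt_dvdP p_pr _ n_dv) // -?os // neq_ltn X_gt1 orbT.
Qed.


Hypothesis X_cycle : cycle_set X.

Lemma sigmaM x y : sigma y * sigma (sigma y x) = sigma x * sigma (sigma x y).
Proof. by apply/permP=> z; rewrite !permM !sigmaE X_cycle. Qed.

(** Having equal [sigma] is a congruence; were it total, the generators of [D] would be trivial. *)
Lemma simple_retraction : D :!=: 1 -> injective (@sigma X).
Proof.
have sigma_eq x x' y :
    sigma x = sigma x' -> sigma (sigma y x) = sigma (sigma y x').
  move=> E; apply: (mulgI (sigma y)); by rewrite (sigmaM x) (sigmaM x') E.
have sigma_eqV x x' y : sigma x = sigma x' ->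
    sigma ((sigma y)^-1 x) = sigma ((sigma y)^-1 x').
  (* By finiteness the inverse of [sigma y] is a power of it, so [sigma_eq] can be iterated. *)
  rewrite invg_expg => E; elim: _.-1 => [|n IH]; first by rewrite expg0 !perm1.
  by rewrite expgSr !permM; apply: sigma_eq.
have rcong : congruence (fun x y : X => sigma x == sigma y).
  split=> [x y z|x x' y y' /eqP E /eqP E'|x x' y y' /eqP E /eqP E'].
  - by split=> // /eqP->.
  - by rewrite -!sigmaE -E; apply/eqP/sigma_eq.
  - by rewrite -E; apply/eqP/sigma_eqV.
move=> D_n1; case: (X_simple rcong) => [E x y /eqP|E]; first by rewrite E => /eqP.
case/negP: D_n1; rewrite -subG1; apply: Dis_subset => [|x y]; first exact: normal1.
by rewrite (eqP (E y x)) mulVg group1.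
Qed.

(** * The abelian group of translations of [G] *)

Hypothesis X_nondeg : nondegenerate X.

(* In terms of maps, g |-> sigma_(g x) o g; nondegeneracy gives injectivity. *)
Definition brace_add_fun x g := if g \in G then g * sigma (g x) else g.

Lemma brace_add_fun_inj x : injective (brace_add_fun x).
Proof.
have memG g : g \in G -> g * sigma (g x) \in G.
  by move=> Gg; rewrite groupM ?mem_sigma.
move=> g h; rewrite /brace_add_fun.
case: ifPn => Gg; case: ifPn => Gh // E; first 1 last.
- by rewrite -E memG in Gh.
- by rewrite E memG in Gg.
(* Evaluated at [x], the two sides of [E] are the squares of [g x] and [h x]. *)
have Egh : g x = h x.
  by have:= congr1 (fun s : {perm X} => s x) E; rewrite !permM !sigmaE => /(bij_inj X_nondeg).
by move: E; rewrite Egh; apply: mulIg.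
Qed.

Definition tau x : {perm {perm X}} := perm (@brace_add_fun_inj x).

Lemma tauE x g : g \in G -> tau x g = g * sigma (g x).
Proof. by rewrite permE /brace_add_fun => ->. Qed.

Lemma tau1 x : tau x 1 = sigma x.
Proof. by rewrite tauE ?group1 // mul1g perm1. Qed.

Definition addG : {group {perm {perm X}}} := <<[set tau x | x : X]>>%G.
Local Notation A := addG.

Lemma mem_tau x : tau x \in A.
Proof. by rewrite mem_gen // imset_f. Qed.

Lemma tau_out x g : g \notin G -> tau x g = g.
Proof. by rewrite permE /brace_add_fun => /negPf->. Qed.

Lemma tau_mem x g : (tau x g \in G) = (g \in G).
Proof.
have [Gg|nGg] := boolP (g \in G); last by rewrite tau_out // (negPf nGg).
by rewrite tauE // groupM ?mem_sigma.
Qed.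

Lemma addG_abelian : abelian A.
Proof.
rewrite abelian_gen; apply/centsP=> _ /imsetP[x _ ->] _ /imsetP[y _ ->].
apply/permP=> g; rewrite !permM.
have [Gg|nGg] := boolP (g \in G); last by rewrite !tau_out.
by rewrite !tauE ?groupM ?mem_sigma // !permM -!mulgA sigmaM.
Qed.

Lemma addG_astabs : A \subset 'N(G | 'P).
Proof.
rewrite gen_subG; apply/subsetP=> _ /imsetP[x _ ->].
by apply/astabsP=> g; rewrite /= /aperm tau_mem.
Qed.

Lemma addG_mem a g : a \in A -> (a g \in G) = (g \in G).
Proof. by move=> Aa; have /astabsP/(_ g) := subsetP addG_astabs a Aa. Qed.

Lemma addG_out a g : a \in A -> g \notin G -> a g = g.
Proof.
move=> Aa nGg; suffices /subsetP/(_ a Aa): A \subset 'C[g | 'P] by move/astab1P.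
rewrite gen_subG; apply/subsetP=> _ /imsetP[x _ ->].
by apply/astab1P; rewrite /= /aperm tau_out.
Qed.

Lemma addG_orbit1 g : g \in G -> exists2 a, a \in A & a 1 = g.
Proof.
have sOG h : h \in orbit 'P A 1 -> h \in G.
  by case/orbitP=> a Aa <-; rewrite /= /aperm addG_mem ?group1.
have sGN : G \subset 'N(orbit 'P A 1 | 'R).
  rewrite gen_subG; apply/subsetP=> _ /imsetP[x _ ->].
  rewrite !inE; apply/subsetP=> h Oh; rewrite inE /=.
  (* The index [h^-1 x] undoes the twist: this translation multiplies [h] by
     [sigma (h (h^-1 x))]. *)
  have -> : h * sigma x = tau (h^-1 x) h by rewrite tauE ?sOG // permKV.
  apply: (orbit_trans _ Oh).
  by apply/orbitP; exists (tau (h^-1 x)) => //; apply: mem_tau.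
move=> Gg; have /astabsP/(_ 1) := subsetP sGN g Gg.
by rewrite orbit_refl /= mul1g => /orbitP[a Aa <-]; exists a.
Qed.

(** An abelian group that is transitive on [G] has trivial point stabilisers there. *)
Lemma addG_regular a b : a \in A -> b \in A -> a 1 = b 1 -> a = b.
Proof.
move=> Aa Ab E; apply/permP=> g; have [Gg|nGg] := boolP (g \in G); last first.
  by rewrite !addG_out.
have [c Ac <-] := addG_orbit1 Gg.
by rewrite -!permM ![c * _](centsP addG_abelian) // !permM E.
Qed.

(* The inverse turns left multiplication into a morphism, since products of
   permutations apply their left factor first. *)
Definition lmul k : {perm {perm X}} := perm (mulgI k^-1).

Lemma lmulE k g : lmul k g = k^-1 * g.
Proof. by rewrite permE. Qed.

Lemma lmulM : {in G &, {morph lmul : k h / k * h}}.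
Proof. by move=> k h _ _; apply/permP=> g; rewrite permM !lmulE invMg mulgA. Qed.

Canonical lmul_morphism := Morphism lmulM.

Lemma conj_lmulE a k g : (a ^ lmul k) (k^-1 * g) = k^-1 * a g.
Proof. by rewrite -!lmulE permJ. Qed.

Lemma tauJ x k : k \in G -> tau x ^ lmul k = tau (k x).
Proof.
move=> Gk; apply/permP=> g; rewrite -{1}(mulKg k g) conj_lmulE.
have [Gg|nGg] := boolP (g \in G).
  by rewrite !tauE ?groupM // permM -mulgA mulKg.
by rewrite !tau_out ?groupMl // mulKg.
Qed.

Lemma addG_norm : lmul @* G \subset 'N(A).
Proof.
apply/subsetP=> _ /morphimP[k _ Gk ->]; rewrite inE -genJ genS //.
apply/subsetP=> _ /imsetP[_ /imsetP[x _ ->] ->].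
by rewrite tauJ // imset_f.
Qed.

Lemma memJ_lmul (N : {group {perm {perm X}}}) a k :
  lmul @* G \subset 'N(N) -> k \in G -> (a ^ lmul k \in N) = (a \in N).
Proof. by move=> nNL Gk; rewrite memJ_norm ?(subsetP nNL) ?mem_morphim. Qed.

(** With [A] identified with [G] through [a 1], a product is a sum whose second term is twisted by
    the first factor. *)
Lemma addG_mul c a : c \in A -> a \in A ->
  c 1 * a 1 = (c * a ^ lmul (c 1)^-1) 1.
Proof.
move=> Ac Aa; have := conj_lmulE a (c 1)^-1 1.
by rewrite invgK mulg1 (permM c).
Qed.

Lemma card_addG : #|A| = #|G|.
Proof.
have inj : {in A &, injective (fun a : {perm {perm X}} => a 1)}.
  by move=> a b; apply: addG_regular.
rewrite -(card_in_imset inj); apply: eq_card => g.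
apply/imsetP/idP=> [[a Aa ->]|/addG_orbit1[a Aa <-]]; last by exists a.
by rewrite addG_mem ?group1.
Qed.

(** * Left ideals and the congruences they induce *)

Section LeftIdeal.

Variable N : {group {perm {perm X}}}.
Hypotheses (sNA : N \subset A) (nNL : lmul @* G \subset 'N(N)).

Definition lideal_set : {set {perm X}} := [set a 1 | a : {perm {perm X}} in N].

Lemma lideal_group_set : group_set lideal_set.
Proof.
apply/group_setP; split=> [|_ _ /imsetP[a Na ->] /imsetP[b Nb ->]].
  by apply/imsetP; exists 1; rewrite ?perm1.
have Aa := subsetP sNA a Na; rewrite addG_mul ?(subsetP sNA) //.
by rewrite imset_f // groupM // memJ_lmul // groupV addG_mem ?group1.
Qed.

Definition lideal : {group {perm X}} := Group lideal_group_set.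

Lemma lideal_sub : lideal \subset G.
Proof.
by apply/subsetP=> _ /imsetP[a Na ->]; rewrite addG_mem ?group1 ?(subsetP sNA).
Qed.

Lemma mem_lideal a : a \in A -> (a 1 \in lideal) = (a \in N).
Proof.
move=> Aa; apply/imsetP/idP=> [[b Nb /addG_regular-> //]|]; last by exists a.
exact: subsetP sNA b Nb.
Qed.

Lemma card_lideal : #|lideal| = #|N|.
Proof.
rewrite card_in_imset // => a b Na Nb; apply: addG_regular; exact: subsetP sNA _ _.
Qed.

(** By [addG_mul] the quotient in [G] is the difference in [A] twisted by [c 1], and [N] is stable
    under such twists. *)
Lemma lideal_coset c d : c \in A -> d \in A ->
  ((c 1)^-1 * d 1 \in lideal) = (c^-1 * d \in N).
Proof.
move=> Ac Ad; have Gc : c 1 \in G by rewrite addG_mem ?group1.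
have Acd : c^-1 * d \in A by rewrite groupM ?groupV.
have Ab : (c^-1 * d) ^ lmul (c 1) \in A by rewrite memJ_lmul ?addG_norm.
have <- : c 1 * ((c^-1 * d) ^ lmul (c 1)) 1 = d 1.
  by rewrite addG_mul // -conjgM -lmulM ?groupV // mulgV morph1 conjg1 mulKVg.
by rewrite mulKg mem_lideal // memJ_lmul.
Qed.

(** This translates normality of [lideal] into the trivial action of its elements on [A] modulo [N];
    both directions are needed below. *)
Lemma lideal_conj a c : a \in N -> c \in A ->
  ((a 1) ^ (c 1) \in lideal) = (c^-1 * c ^ lmul (a 1)^-1 \in N).
Proof.
move=> Na Ac; have Aa := subsetP sNA a Na.
have Ga : a 1 \in G by rewrite addG_mem ?group1.
have Ac' : c ^ lmul (a 1)^-1 \in A by rewrite memJ_lmul ?addG_norm ?groupV.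
rewrite [(a 1) ^ _]conjgE addG_mul // lideal_coset ?(groupM Aa Ac') //.
by rewrite mulgA (centsP addG_abelian c^-1 _ a Aa) ?groupV // -mulgA groupMl.
Qed.

Lemma Dis_sub_lideal :
  (forall x y, (tau x)^-1 * tau y \in N) -> D \subset lideal.
Proof.
move=> Ndiff.
have Nact a k : a \in A -> k \in G -> a^-1 * a ^ lmul k \in N.
  (* The elements fixed by [G] modulo [N] form a subgroup; it contains each [tau x], as [G] permutes
     the [tau x] and these agree modulo [N]. *)
  pose H := [set a in A | [forall k in G, a^-1 * a ^ lmul k \in N]].
  have gH : group_set H.
    apply/group_setP; split=> [|b c].
      by rewrite inE group1; apply/forall_inP=> h _; rewrite conj1g invg1 mulg1 group1.
    rewrite !inE => /andP[Ab /forall_inP Hb] /andP[Ac /forall_inP Hc].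
    rewrite groupM //; apply/forall_inP=> h Gh.
    rewrite conjMg invMg -mulgA [b^-1 * _]mulgA mulgA.
    rewrite (centsP addG_abelian c^-1 _ (b^-1 * b ^ lmul h)) ?groupV //.
      by rewrite -mulgA groupM ?Hb ?Hc.
    by rewrite (subsetP sNA) ?Hb.
  have sAH : A \subset Group gH.
    rewrite gen_subG; apply/subsetP=> _ /imsetP[x _ ->]; rewrite !inE mem_tau.
    by apply/forall_inP=> h Gh; rewrite tauJ ?Ndiff.
  by move=> Aa Gk; have /setIdP[_ /forall_inP->] := subsetP sAH a Aa.
apply: Dis_subset => [|x y]; last by rewrite -!tau1 lideal_coset ?mem_tau.
rewrite /normal lideal_sub; apply/subsetP=> k Gk; rewrite inE.
apply/subsetP=> _ /imsetP[_ /imsetP[a Na ->] ->].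
have [c Ac <-] := addG_orbit1 Gk.
by rewrite lideal_conj // Nact // groupV addG_mem ?group1 ?(subsetP sNA).
Qed.

(** Normality makes [lideal] fix every [tau x] modulo [N], while related [x] and [y] have [sigma x]
    and [sigma y] in one coset of [lideal]. *)
Lemma lideal_congruence : G \subset 'N(lideal) ->
  congruence (fun x y => (tau x)^-1 * tau y \in N).
Proof.
move=> nQG.
have relG k x y : k \in G ->
    ((tau (k x))^-1 * tau (k y) \in N) = ((tau x)^-1 * tau y \in N).
  by move=> Gk; rewrite -!tauJ // -conjVg -conjMg memJ_lmul.
have relQ q x : q \in lideal -> (tau x)^-1 * tau (q x) \in N.
  move=> Qq; have Gq := subsetP lideal_sub q Qq.
  (* [lideal_conj] twists by the inverse of [a 1], hence the choice of [a] over [q^-1]. *)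
  have /imsetP[a Na qV] : q^-1 \in lideal by rewrite groupV.
  rewrite -tauJ // -[q]invgK qV -lideal_conj ?mem_tau // -qV.
  by rewrite memJ_norm ?groupV // (subsetP nQG) // addG_mem ?group1 ?mem_tau.
have relT x y z : (tau x)^-1 * tau y \in N ->
    ((tau x)^-1 * tau z \in N) = ((tau y)^-1 * tau z \in N).
  by move=> Nxy; rewrite -(groupMl _ (groupVr Nxy)) invMg invgK -mulgA mulKVg.
have relQ_sigma x y : (tau x)^-1 * tau y \in N -> (sigma x)^-1 * sigma y \in lideal.
  by move=> Nxy; rewrite -!tau1 lideal_coset ?mem_tau.
split=> [x y z|x x' y y' rxx' ryy'|x x' y y' rxx' ryy'].
- by split=> [|/relT->]; rewrite ?mulVg.
- rewrite -!sigmaE (relT _ (sigma x y')) ?relG ?mem_sigma //.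
  by rewrite -[sigma x'](mulKVg (sigma x)) permM relQ ?relQ_sigma.
- rewrite (relT _ ((sigma x)^-1 y')) ?relG ?groupV ?mem_sigma //.
  rewrite -(relG (sigma x')) ?mem_sigma // permKV.
  set z := (sigma x)^-1 y'.
  have -> : y' = ((sigma x')^-1 * sigma x) (sigma x' z).
    by rewrite permM permK permKV.
  by rewrite relQ // -groupV invMg invgK relQ_sigma.
Qed.

End LeftIdeal.


(** * Indecomposable cycle sets of prime size *)

Lemma prime_indecomposable_Dis1 :
  indecomposable X -> prime #|X| -> #|D| = 1%N.
Proof.
set p := #|X| => trG p_pr.
have cAA := addG_abelian; have nilA := abelian_nil cAA.
have pG : p %| #|G| by have := atrans_dvd trG; rewrite cardsT.
have logG : logn p #|G| = 1%N.
  apply/eqP; rewrite eqn_leq logn_gt0 mem_primes p_pr cardG_gt0 pG.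
  by rewrite -(logn_fact_prime p_pr) dvdn_leq_log ?fact_gt0 ?dvdn_card_perm.
pose P := 'O_p(A)%G; pose N := 'O_p^'(A)%G.
have oP : #|P| = p.
  rewrite (card_Hall (nilpotent_pcore_Hall p nilA)) p_part card_addG logG.
  by rewrite expn1.
have defA : P \x N = A := nilpotent_pcoreC p nilA.
have normO pi : lmul @* G \subset 'N('O_pi(A)).
  exact: char_norm_trans (pcore_char _ _) addG_norm.
have [s Gs os] := Cauchy p_pr pG.
have sSG : <[s]> \subset G by rewrite cycle_subG.
(* The fixed points of [s] in [P] form a nontrivial subgroup, which is [P] as the order is prime. *)
have cPS : lmul @* <[s]> \subset 'C(P).
  have pS : p.-group <[s]> by rewrite /pgroup -/#[s] os pnat_id.
  have P_n1 : P :!=: 1 by rewrite -cardG_gt1 oP prime_gt1.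
  have := pgroup_cent_nontrivial (pcore_pgroup p A) (morphim_pgroup lmul_morphism pS).
  move=> /(_ (subset_trans (morphimS _ sSG) (normO p)) P_n1) C_n1.
  by rewrite centsC; apply: prime_meetG; rewrite ?oP.
have trS : [transitive <[s]>, on [set: X] | 'P].
  have [x sx_n] : exists x, s x != x.
    apply/existsP; rewrite -negb_forall; apply: contraL (prime_gt1 p_pr).
    move=> /forallP s1; rewrite -os; suffices -> : s = 1 by rewrite order1.
    by apply/permP=> x; rewrite perm1; apply/eqP/s1.
  apply/imsetP; exists x => //; apply/esym/eqP.
  rewrite eqEcard subsetT cardsT -/p.
  have dv : #|orbit 'P <[s]> x| %| p by rewrite -os; apply: dvdn_orbit.
  rewrite (prime_nt_dvdP p_pr _ dv) ?leqnn //.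
  apply: contra sx_n => /eqP/card_orbit1 o1; rewrite -in_set1 -o1.
  by apply/orbitP; exists s; rewrite ?cycle_id.
have Ndiff x y : (tau x)^-1 * tau y \in N.
  have [k Sk ->] := atransP2 trS (in_setT x) (in_setT y).
  have Gk := subsetP sSG k Sk.
  rewrite /= /aperm -tauJ //.
  (* The component [u] in [P] is fixed by [k] and cancels in the difference. *)
  have [u [v [Pu Nv -> _]]] := mem_dprod defA (mem_tau x).
  have -> : (u * v) ^ lmul k = u * v ^ lmul k.
    rewrite conjMg; congr (_ * _); apply/conjg_fixP/commgP.
    by apply/commute_sym/(centsP cPS) => //; apply: mem_morphim.
  by rewrite invMg -mulgA mulKg groupM ?groupV // memJ_lmul // normO.
have sND := Dis_sub_lideal (pcore_sub _ _) (normO _) Ndiff.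
have [-> |trD] := simple_orbits (normal_norm Dis_normal) (subxx _).
  by rewrite cards1.
have := dvdn_trans (atrans_dvd trD) (cardSg sND).
rewrite card_lideal cardsT -/p => pN; have := pcore_pgroup p^' A.
by move/pgroupP/(_ p p_pr pN); rewrite !inE eqxx.
Qed.


(** * Cyclic displacement groups *)

Definition add_diff : {group {perm {perm X}}} :=
  <<[set ((tau x)^-1 * tau y)%g | x : X, y : X]>>%G.

Lemma mem_add_diff x y : (tau x)^-1 * tau y \in add_diff.
Proof. by rewrite mem_gen //; apply/imset2P; exists x y. Qed.

Lemma add_diff_sub : add_diff \subset A.
Proof.
rewrite gen_subG; apply/subsetP=> _ /imset2P[x y _ _ ->].
by rewrite groupM ?groupV ?mem_tau.
Qed.

Lemma add_diff_norm : lmul @* G \subset 'N(add_diff).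
Proof.
apply/subsetP=> _ /morphimP[k _ Gk ->]; rewrite inE -genJ genS //.
apply/subsetP=> _ /imsetP[_ /imset2P[x y _ _ ->] ->].
by rewrite conjMg conjVg !tauJ //; apply/imset2P; exists (k x) (k y).
Qed.

Lemma lideal_add_diff : lideal add_diff_sub add_diff_norm = D.
Proof.
apply/val_inj/eqP; rewrite /= eqEsubset.
apply/andP; split; last exact: (Dis_sub_lideal add_diff_sub add_diff_norm mem_add_diff).
(* [H] collects the elements of [A] that move each [h] within its coset of [D]. *)
pose H := [set a in A | [forall h in G, h^-1 * a h \in D]].
have gH : group_set H.
  apply/group_setP; split=> [|b c].
    by rewrite inE group1; apply/forall_inP=> h _; rewrite perm1 mulVg group1.
  rewrite !inE => /andP[Ab /forall_inP Hb] /andP[Ac /forall_inP Hc].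
  rewrite groupM //; apply/forall_inP=> h Gh; rewrite permM.
  by rewrite -[c _](mulKVg (b h)) mulgA groupM ?Hb ?Hc ?addG_mem.
have sH : add_diff \subset Group gH.
  rewrite gen_subG; apply/subsetP=> _ /imset2P[x y _ _ ->].
  rewrite inE (subsetP add_diff_sub _ (mem_add_diff x y)).
  apply/forall_inP=> h Gh.
  rewrite permM; set g := (tau x)^-1 h.
  have Gg : g \in G by rewrite addG_mem ?groupV ?mem_tau ?Gh.
  have -> : h = tau x g by rewrite permKV.
  by rewrite !tauE // invMg -mulgA mulKg mem_Dis.
apply/subsetP=> _ /imsetP[a Na ->].
have /setIdP[_ /forall_inP/(_ 1 (group1 _))] := subsetP sH a Na.
by rewrite invg1 mul1g.
Qed.

Lemma cyclic_Dis1 : 1 < #|X| -> cyclic D -> #|D| = 1%N.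
Proof.
move=> X_gt1 cycD; have cDD := cyclic_abelian cycD.
have [-> |D_n1] := eqVneq (gval D) 1; first by rewrite cards1.
have sDG := normal_sub Dis_normal; have nDG := normal_norm Dis_normal.
have tau_inj : injective tau.
  move=> x y /(congr1 (fun a : {perm {perm X}} => a 1)).
  by rewrite !tau1; apply: simple_retraction.
have trD : [transitive D, on [set: X] | 'P].
  by case: (simple_orbits nDG (subxx _)) => // D1; rewrite D1 eqxx in D_n1.
have /card_gt0P[x0 _] : 0 < #|X| by apply: ltnW.
have oD : #|D| = #|X|.
  apply/eqP; rewrite eqn_leq; apply/andP; split; last first.
    by rewrite -cardsT dvdn_leq ?(atrans_dvd trD).
  (* A transitive abelian group is regular. *)
  suffices inj : {in D &, injective (fun d : {perm X} => d x0)}.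
    by rewrite -(card_in_imset inj) max_card.
  move=> d e Dd De E.
  apply/permP=> y; have [h Dh ->] := atransP2 trD (in_setT x0) (in_setT y).
  by rewrite /= /aperm -!permM !(centsP cDD h) // !permM E.
have sBA := add_diff_sub; have nBG := add_diff_norm.
have oB : #|add_diff| = #|X|.
  by rewrite -oD -lideal_add_diff card_lideal.
have tau_coset x b : b \in add_diff -> exists y, tau x * b = tau y.
  move=> Bb; suffices : tau x * b \in [set tau y | y : X].
    by case/imsetP=> y _ ->; exists y.
  have -> : [set tau y | y : X] = tau x *: add_diff.
    apply/eqP; rewrite eqEcard card_lcoset oB card_imset // leqnn andbT.
    by apply/subsetP=> _ /imsetP[y _ ->]; rewrite mem_lcoset mem_add_diff.
  by rewrite mem_lcoset mulKg.
have irrB (K : {group {perm {perm X}}}) :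
    K \subset add_diff -> lmul @* G \subset 'N(K) -> K :!=: 1 -> K :=: add_diff.
  move=> sKB nKG K_n1; have sKA := subset_trans sKB sBA.
  have nQG : G \subset 'N(lideal sKA nKG).
    (* Every subgroup of the cyclic group [D] is characteristic in it. *)
    apply: char_norm_trans nDG; rewrite sub_cyclic_char // -lideal_add_diff.
    exact: imsetS.
  case: (X_simple (lideal_congruence nQG)) => [eqK|totK]; last first.
    apply/eqP; rewrite eqEsubset sKB gen_subG.
    by apply/subsetP=> _ /imset2P[x y _ _ ->]; apply: totK.
  case/eqP: K_n1; apply/trivgP/subsetP=> b Kb; apply/set1P.
  (* Adding [b] to [tau x0] gives [tau y] for some [y] related to [x0], so [y] is [x0] and [b] is
     trivial. *)
  have [y E] := tau_coset x0 b (subsetP sKB b Kb).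
  have := eqK x0 y; rewrite -E mulKg Kb => /esym/eqP x0y.
  by apply: (mulgI (tau x0)); rewrite E x0y mulg1.
have B_n1 : add_diff :!=: 1 by rewrite -cardG_gt1 oB.
have [p p_pr abB] : exists2 p, prime p & p.-abelem add_diff.
  apply/is_abelemP/charsimple_solvable; last first.
    exact/abelian_sol/(abelianS sBA)/addG_abelian.
  apply/charsimpleP; split=> // K K_n1 chK; apply: irrB => //.
    exact: char_sub chK.
  exact: char_norm_trans chK nBG.
have cBD : lmul @* D \subset 'C(add_diff).
  have pD : p.-group D by rewrite /pgroup oD -oB; apply: abelem_pgroup abB.
  have nBD := subset_trans (morphimS _ sDG) nBG.
  have C_n1 := pgroup_cent_nontrivial (abelem_pgroup abB)
    (morphim_pgroup lmul_morphism pD) nBD B_n1.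
  (* The centraliser of [D] in [add_diff] is [G]-stable since [D] is normal in [G]. *)
  rewrite centsC; apply/setIidPl; apply: irrB C_n1; first exact: subsetIl.
  by rewrite normsI // norms_cent // morphim_norms.
have expD d : d \in D -> d ^+ p = 1.
  move=> Dd; have Gd := subsetP sDG d Dd; apply/permP=> x; rewrite perm1.
  pose t := (tau x)^-1 * tau (d x); have Bt : t \in add_diff by apply: mem_add_diff.
  (* Since [d] fixes [t], the [tau ((d ^+ i) x)] form an arithmetic progression with difference
     [t]. *)
  suffices tauX i : tau ((d ^+ i) x) = tau x * t ^+ i.
    by apply: tau_inj; have [_ expB] := abelemP p_pr abB; rewrite tauX expB // mulg1.
  elim: i => [|i IH]; first by rewrite !expg0 perm1 mulg1.
  have tJ : t ^ lmul d = t.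
    apply/conjg_fixP/commgP/commute_sym/(centsP cBD) => //.
    exact: mem_morphim.
  rewrite expgSr permM -tauJ // IH conjMg tauJ // conjXg tJ.
  by rewrite [t ^+ _.+1]expgS mulgA; congr (_ * _); rewrite mulKVg.
have pX : prime #|X|.
  have [d defD] := cyclicP cycD.
  have dp : #|X| %| p.
    by rewrite -oD defD -/(#[d]) order_dvdn expD // defD cycle_id.
  by rewrite (prime_nt_dvdP p_pr _ dp) // neq_ltn X_gt1 orbT.
apply: prime_indecomposable_Dis1 pX.
apply/imsetP; exists x0 => //; apply/setP=> y; rewrite in_setT; apply/esym.
have [d Dd ->] := atransP2 trD (in_setT x0) (in_setT y).
by apply/orbitP; exists d => //; apply: subsetP sDG d Dd.
Qed.

End Displacement.

Close Scope group_scope.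

Theorem theorem42 (X : finLeftQuasigroup) (X_cycle : cycle_set X)
    (X_nondeg : nondegenerate X) (X_simple : simple_lq X)
    (X_nontrivial : 1 < #|X|) :
  [<-> cyclic (Dis X);
       #|Dis X| = 1;
       #|X| = 2 \/ (indecomposable X /\ prime #|X|)].
Proof.
tfae; first exact: cyclic_Dis1.
  exact: trivial_Dis_simple.
case=> [X2|[trG pX]].
  (* On two points the order of [Dis X] divides 2!, which is prime. *)
  have := dvdn_card_perm (Dis X); rewrite X2; exact: dvdn_prime_cyclic.
by rewrite (card1_trivg (prime_indecomposable_Dis1 X_simple X_cycle X_nondeg trG pX)) cyclic1.
Qed.
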